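(* For each even integer $w\geqslant 4$ there is a partial Steiner triple system whose leave $L$ (a graph on $u$ vertices, say) satisfies all of the following conditions, and yet the graph $L\vee K_w$ has no $K_3$-decomposition: (1) $\deg_L(x)\equiv w \pmod 2$ for each vertex $x$ of $L$; (2) $u+w$ is odd if $w>0$; (3) $|E(L)|+uw+\binom{w}{2}\equiv 0\pmod 3$; (4) there is a subgraph $G$ of $L$ such that (i) $L-G$ has a $K_3$-decomposition, (ii) $w^2-(u+1)w+2|E(G)|\geqslant 0$, and (iii) $G$ is $w$-edge colourable.
   Context: A partial Steiner triple system $(U,\mathcal{A})$ consists of a finite set $U$ and a set $\mathcal{A}$ of 3-element subsets of $U$ such that any two elements of $U$ lie together in at most one triple. Its leave is the graph with vertex set $U$ whose edges are the pairs $xy$ not contained in any triple of $\mathcal{A}$. A $K_3$-decomposition of a graph is a set of triangles in it such that each edge lies in exactly one of them. For vertex-disjoint graphs $G,H$, $G\vee H$ is the graph on $V(G)\cup V(H)$ with edge set $E(G)\cup E(H)\cup\{xy: x\in V(G), y\in V(H)\}$; $K_w$ is the complete graph on $w$ new vertices. For graphs $G\subseteq L$, $L-G$ has vertex set $V(L)$ and edge set $E(L)\setminus E(G)$. Edge colourings are proper. *)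

(* Defs.v *)
(* Graphs are given by edge sets: sets of 2-element subsets
   of a finite vertex type. *)
From mathcomp Require Import all_boot.
Set Implicit Arguments. Unset Strict Implicit. Unset Printing Implicit Defensive.

Section Defs.
Variable T : finType.

Definition partial_STS (A : {set {set T}}) : Prop :=
  (forall t, t \in A -> #|t| = 3) /\
  (forall t1 t2, t1 \in A -> t2 \in A -> t1 != t2 -> #|t1 :&: t2| <= 1).

Definition leave (A : {set {set T}}) : {set {set T}} :=
  [set e : {set T} | (#|e| == 2) && [forall t in A, ~~ (e \subset t)]].

Definition deg (E : {set {set T}}) (x : T) : nat := #|[set e in E | x \in e]|.

Definition K3_decomposition (E : {set {set T}}) (D : {set {set T}}) : Prop :=
  (forall t, t \in D -> #|t| = 3 /\
     (forall e : {set T}, e \subset t -> #|e| = 2 -> e \in E)) /\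
  (forall e, e \in E -> #|[set t in D | e \subset t]| = 1).

Definition has_K3_decomposition (E : {set {set T}}) : Prop :=
  exists D, K3_decomposition E D.

Definition edge_colourable (k : nat) (E : {set {set T}}) : Prop :=
  exists c : {set T} -> 'I_k,
    forall e f, e \in E -> f \in E -> e != f -> e :&: f != set0 -> c e != c f.
End Defs.

Definition join_K (u w : nat) (E : {set {set 'I_u}}) : {set {set ('I_u + 'I_w)%type}} :=
  [set (@inl 'I_u 'I_w) @: e | e : {set 'I_u} in E] :|:
  [set e : {set ('I_u + 'I_w)%type} | (#|e| == 2) && [exists i : 'I_w, inr i \in e]].

(* Main.v *)
Require Import Defs.
From mathcomp Require Import all_boot zify.
Set Implicit Arguments. Unset Strict Implicit. Unset Printing Implicit Defensive.

(** The leave [L] is arranged to have [w(u+1-w)/2] edges, so that (ii) holds with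
    equality for [G = L].  In a decomposition of [L \/ K_w] every edge of [L] then
    lies in a triangle with a new vertex, and each new vertex induces a matching
    of [L].  Moreover [L] has no edge leaving a set [S] of even size in which all
    degrees are [w], except for two vertices [x], [y] of degree [w-2].  By parity
    a new vertex is missed by the matching edges at [x] exactly when it is missed
    at [y], so the same two new vertices [i], [j] are missed at both, and the edge
    [ij] would lie in the triangles [xij] and [yij].

    To build [L], take the Steiner triple system on [V + option V] obtained by
    doubling the affine triple system on [V = F_3^2 x F_3^k], remove the points
    of a [w]-subset [W] of [V] containing no triple, and colour each pair whose
    third point is [c] in [W] with [c].  This partial system contains one of order
    15 with 4 colours, namely over [F_3^2 x {0}], and it is replaced by another
    one with equally many coloured pairs, in which [x] and [y] miss the same two
    colours.  The doubling makes [S = option V] even. *)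

Require Import Defs.
From mathcomp Require Import all_boot zify.
Set Implicit Arguments. Unset Strict Implicit. Unset Printing Implicit Defensive.

(** * Small sets, pairings and triangle decompositions *)

Lemma card2_set (T : finType) (e : {set T}) x :
  #|e| = 2 -> x \in e -> exists2 y, x != y & e = [set x; y].
Proof.
move=> /eqP/cards2P [a [b [ab ->]]]; rewrite !inE => /orP [] /eqP ->.
  by exists b.
by exists a; rewrite 1?eq_sym // setUC.
Qed.

Lemma set3_third_inj (T : finType) (a b c c' : T) :
  a != c -> b != c -> [set a; b; c] = [set a; b; c'] -> c = c'.
Proof.
move=> ac bc E; have : c \in [set a; b; c'] by rewrite -E !inE eqxx orbT.
by rewrite !inE eq_sym (negbTE ac) eq_sym (negbTE bc) => /eqP.
Qed.

Lemma card3_set (T : finType) (t : {set T}) a b :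
  #|t| = 3 -> a \in t -> b \in t -> a != b ->
  exists c, [/\ a != c, b != c & t = [set a; b; c]].
Proof.
move=> t3 at_ bt ab.
have : #|t :\: [set a; b]| = 1.
  rewrite cardsD (setIidPr _) ?t3 ?cards2 ?ab //.
  by apply/subsetP => x; rewrite !inE => /orP [] /eqP ->.
move/eqP/cards1P => [c Ec].
have : c \in t :\: [set a; b] by rewrite Ec set11.
rewrite !inE negb_or => /andP [/andP [ca cb] ct].
exists c; split; rewrite 1?eq_sym //; apply/esym/eqP; rewrite eqEcard t3.
apply/andP; split.
  by apply/subsetP => x; rewrite !inE -orbA => /or3P [] /eqP ->.
by rewrite setUC cardsU1 !inE negb_or ca cb cards2 ab.
Qed.

Lemma involution_even (T : finType) (A : {set T}) (s : T -> T) :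
  {in A, forall x, [/\ s x \in A, s x != x & s (s x) = x]} -> ~~ odd #|A|.
Proof.
move En: #|A| => n; elim/ltn_ind: n A En => n IH A En sA.
have [A0|[x xA]] := set_0Vmem A; first by rewrite -En A0 cards0.
have [sxA sxx ssx] := sA x xA.
have xD : x \in A :\ s x by rewrite !inE eq_sym sxx.
have En' : n = #|(A :\ s x) :\ x|.+2.
  by rewrite -En (cardsD1 (s x)) sxA (cardsD1 x (A :\ _)) xD.
rewrite En' /= negbK; apply: (IH _ _ _ erefl); first by lia.
move=> y; rewrite !inE => /and3P [yx ysx yA]; have [syA syy ssy] := sA y yA.
split=> //; rewrite syA andbT; apply/andP; split.
  by apply: contra_neq ysx => <-; rewrite ssy.
by apply: contra_neq yx => E; rewrite -ssx -E ssy.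
Qed.

Lemma card_ordered_pairs (T : finType) (E : {set {set T}}) :
  (forall e, e \in E -> #|e| = 2) ->
  #|[set ij : T * T | (ij.1 != ij.2) && ([set ij.1; ij.2] \in E)]| = 2 * #|E|.
Proof.
move=> E2; rewrite -sum1_card.
rewrite (partition_big (fun ij : T * T => [set ij.1; ij.2]) (mem E)) /=; last first.
  by move=> ij; rewrite inE => /andP [].
rewrite -sum1_card big_distrr /=; apply: eq_bigr => e eE; rewrite muln1.
have /eqP/cards2P [a [b [ab Ee]]] := E2 e eE.
have -> : 2 = #|[set (a, b); (b, a)]|.
  by rewrite cards2 xpair_eqE negb_and ab.
rewrite -sum1_card; apply: eq_bigl => -[i j]; rewrite !inE /= !xpair_eqE.
apply/idP/idP.
  move=> /andP [/andP [ij _] /eqP]; rewrite Ee => Eij.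
  have : i \in [set a; b] by rewrite -Eij !inE eqxx.
  have : j \in [set a; b] by rewrite -Eij !inE eqxx orbT.
  rewrite !inE => jE iE; move: ij.
  by case/orP: iE => /eqP ->; case/orP: jE => /eqP ->; rewrite ?eqxx ?orbT.
case/orP => /andP [/eqP -> /eqP ->]; first by rewrite -Ee ab eE eqxx.
by rewrite [[set b; a]]setUC -Ee eE eqxx eq_sym ab.
Qed.

(** Uniqueness of the triangle on an edge makes its third vertex a well-defined, symmetric and
    involutive operation. A decomposition is used below only in this form. *)
Lemma third_vertex (Z : finType) (E : {set {set Z}}) :
  has_K3_decomposition E ->
  exists tau : Z -> Z -> Z, forall a b, a != b -> [set a; b] \in E ->
    [/\ tau a b != a, [set a; tau a b] \in E, tau b a = tau a b &
        tau a (tau a b) = b].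
Proof.
case=> D [D1 D2].
pose tau a b := odflt a [pick c | [&& a != c, b != c & [set a; b; c] \in D]].
have tauE a b c : a != b -> a != c -> b != c -> [set a; b; c] \in D -> tau a b = c.
  move=> ab ac bc cD; rewrite /tau; case: pickP => [c' /and3P [ac' bc' cD']|/(_ c)] /=; last first.
    by rewrite ac bc cD.
  have abE : [set a; b] \in E.
    apply: (proj2 (D1 _ cD)); last by rewrite cards2 ab.
    by apply: subsetUl.
  have /eqP/cards1P [t Et] := D2 _ abE.
  apply/esym/(set3_third_inj ac bc).
  have : [set a; b; c] \in [set t] by rewrite -Et inE cD subsetUl.
  have : [set a; b; c'] \in [set t] by rewrite -Et inE cD' subsetUl.
  by rewrite !inE => /eqP -> /eqP.
exists tau => a b ab abE.
have /eqP/cards1P [t Et] := D2 _ abE.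
have : t \in [set t in D | [set a; b] \subset t] by rewrite Et set11.
rewrite inE => /andP [tD /subsetP abt].
have at_ : a \in t by apply: abt; rewrite !inE eqxx.
have bt : b \in t by apply: abt; rewrite !inE eqxx orbT.
have [c [ac bc tE]] := card3_set (proj1 (D1 _ tD)) at_ bt ab.
rewrite tE in tD.
have ba : b != a by rewrite eq_sym.
have cb : c != b by rewrite eq_sym.
rewrite (tauE a b c) // (tauE b a c) // 1?[[set b; a]]setUC // (tauE a c b) //.
- split=> //; first by rewrite eq_sym.
  apply: (proj2 (D1 _ tD)); last by rewrite cards2 ac.
  by apply/subsetP => x; rewrite !inE => /orP [] ->; rewrite ?orbT.
- by rewrite setUAC.
Qed.

(** * Leaves coloured by removed points *)

Definition labelled_pairs (X : finType) (W : {set X}) (op : X -> X -> X) : {set X * X} :=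
  [set ab | [&& ab.1 \notin W, ab.2 \notin W, ab.1 != ab.2 & op ab.1 ab.2 \in W]].

(** [op a b] is the third point of the triple on [a], [b]; if it lies in [W], then
    [ab] is an edge of the leave and [op a b] is its colour. *)
Record labelling (X : finType) (W : {set X}) (op : X -> X -> X) : Prop := Labelling {
  op_sym : forall a b, a \notin W -> b \notin W -> a != b -> op a b = op b a;
  op_neql : forall a b, a \notin W -> b \notin W -> a != b -> op a b != a;
  op_invol : forall a b, a \notin W -> b \notin W -> a != b -> op a b \notin W ->
    op a (op a b) = b;
  op_inj : forall a b c, a \notin W -> b \notin W -> c \notin W ->
    a != b -> a != c -> op a b = op a c -> b = c }.

Section Labelled.
Variables (X : finType) (W : {set X}) (op : X -> X -> X) (T : finType) (f : T -> X).
Hypothesis lab : labelling W op.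
Hypothesis f_inj : injective f.
Hypothesis f_notin : forall i, f i \notin W.
Hypothesis f_onto : forall a, a \notin W -> exists i, f i = a.

(** [f] numbers the points outside [W]. A pair whose third point lies in [W] yields no triple, so it
    stays in the leave. *)
Definition triples : {set {set T}} :=
  [set t | [exists i, exists j, exists k,
     [&& i != j, op (f i) (f j) == f k & t == [set i; j; k]]]].

Let opC i j : i != j -> op (f i) (f j) = op (f j) (f i).
Proof. by move=> ij; apply: (op_sym lab) => //; rewrite (inj_eq f_inj). Qed.

Let op_third i j k : i != j -> op (f i) (f j) = f k ->
  [/\ k != i, k != j, op (f i) (f k) = f j & op (f j) (f k) = f i].
Proof.
have aux a b c : a != b -> op (f a) (f b) = f c -> c != a /\ op (f a) (f c) = f b.
  move=> ab E; have fab : f a != f b by rewrite (inj_eq f_inj).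
  split; first by have := op_neql lab (f_notin a) (f_notin b) fab; rewrite E (inj_eq f_inj).
  by rewrite -E; apply: (op_invol lab) => //; rewrite E.
move=> ij E; have [ki Ei] := aux _ _ _ ij E.
have ji : j != i by rewrite eq_sym.
by have [kj Ej] := aux j i k ji (etrans (opC ji) E); split.
Qed.

Lemma triplesP t i j : t \in triples -> i \in t -> j \in t -> i != j ->
  exists k, [/\ op (f i) (f j) = f k, k != i, k != j & t = [set i; j; k]].
Proof.
rewrite inE => /existsP [a /existsP [b /existsP [c /and3P [ab /eqP E /eqP ->]]]].
have [ca cb Ea Eb] := op_third ab E.
have ba : b != a by rewrite eq_sym.
have ac : a != c by rewrite eq_sym.
have bc : b != c by rewrite eq_sym.
have s3 p q r : [set p; q; r] = [set p; r; q] :> {set T} by rewrite setUAC.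
have s2 p q r : [set p; q; r] = [set q; p; r] :> {set T} by rewrite [[set p; q]]setUC.
rewrite !inE -!orbA => /or3P [] /eqP -> /or3P [] /eqP -> ij; try by rewrite eqxx in ij.
- by exists c.
- by exists b; rewrite s3.
- by exists c; rewrite -opC // s2.
- by exists a; split=> //; rewrite s2 s3.
- by exists b; split=> //; [rewrite -opC | rewrite s3 s2].
- by exists a; split=> //; [rewrite -opC | rewrite s2 s3 s2].
Qed.

Lemma triples_card3 t : t \in triples -> #|t| = 3.
Proof.
rewrite inE => /existsP [a /existsP [b /existsP [c /and3P [ab /eqP E /eqP ->]]]].
have [ca cb _ _] := op_third ab E.
by rewrite setUC cardsU1 !inE negb_or ca cb cards2 ab.
Qed.

Lemma triples_partial_STS : partial_STS triples.
Proof.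
split=> [t|t1 t2 t1A t2A]; first exact: triples_card3.
apply: contraR; rewrite -ltnNge => /card_gt1P [i [j [/setIP [i1 i2] /setIP [j1 j2] ij]]].
have [k [E _ _ ->]] := triplesP t1A i1 j1 ij.
have [k' [E' _ _ ->]] := triplesP t2A i2 j2 ij.
by rewrite (f_inj (etrans (esym E) E')).
Qed.

Lemma mem_leave i j :
  ([set i; j] \in leave triples) = (i != j) && (op (f i) (f j) \in W).
Proof.
rewrite inE cards2; case: (altP (i =P j)) => //= ij.
apply/forall_inP/idP => [H|opW t tA].
  apply/negPn/negP => /f_onto [k Ek].
  have /H : [set i; j; k] \in triples.
    rewrite inE; apply/existsP; exists i; apply/existsP; exists j.
    by apply/existsP; exists k; rewrite ij Ek !eqxx.
  by rewrite subsetUl.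
apply/negP => /subsetP ijt.
have [||k [E _ _ _]] := triplesP tA _ _ ij; try by apply: ijt; rewrite !inE eqxx ?orbT.
by have := f_notin k; rewrite -E opW.
Qed.

Lemma card_leave_edge e : e \in leave triples -> #|e| = 2.
Proof. by rewrite inE => /andP [/eqP]. Qed.

(** The points other than [i] are its neighbours [N] in the leave and the points [M] on triples
    through [i]. Taking third points pairs off [M], so the degree has the parity of [#|T| - 1]. *)
Lemma deg_leave_even i : odd #|T| -> ~~ odd (deg (leave triples) i).
Proof.
move=> oddT.
pose N := [set j | (i != j) && (op (f i) (f j) \in W)].
have -> : deg (leave triples) i = #|N|.
  have <- : #|(fun j => [set i; j]) @: N| = #|N|.
    apply: card_in_imset => j j'; rewrite !inE => /andP [ij _] /andP [ij' _] E.
    have : j \in [set i; j'] by rewrite -E !inE eqxx orbT.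
    by rewrite !inE eq_sym (negbTE ij) => /eqP.
  congr #|pred_of_set _|; apply/setP => e; rewrite inE; apply/andP/imsetP.
    move=> [eL ie]; have [j ij Ee] := card2_set (card_leave_edge eL) ie.
    by exists j => //; rewrite inE -mem_leave -Ee.
  by move=> [j]; rewrite inE -mem_leave => jL ->; split=> //; rewrite !inE eqxx.
pose M := [set j | (i != j) && (op (f i) (f j) \notin W)].
have third_of j : j \in M -> exists k, op (f i) (f j) = f k.
  by rewrite inE => /andP [_ /f_onto [k <-]]; exists k.
pose s j := odflt i [pick k | op (f i) (f j) == f k].
have sE j k : op (f i) (f j) = f k -> s j = k.
  move=> E; rewrite /s; case: pickP => [k' /eqP|/(_ k)] /=; last by rewrite E eqxx.
  by rewrite E => /f_inj.
have evenM : ~~ odd #|M|.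
  apply: (involution_even (s := s)) => j jM.
  have [k E] := third_of j jM; rewrite (sE _ _ E).
  have ij : i != j by move: jM; rewrite inE => /andP [].
  have [ki kj Ek _] := op_third ij E.
  by split=> //; [rewrite inE Ek f_notin eq_sym ki | exact: sE].
have : #|T| = (#|N| + #|M|).+1.
  have disj : [disjoint N & M].
    by rewrite -setI_eq0; apply/eqP/setP => j; rewrite !inE; case: (_ \in W); rewrite ?andbF.
  have -> : #|T| = #|i |: (N :|: M)|.
    rewrite -cardsT; apply: eq_card => j; rewrite !inE eq_sym.
    by case: eqP => //= _; case: (_ \in W).
  by rewrite cardsU1 !inE eqxx /= add1n cardsU (disjoint_setI0 disj) cards0 subn0.
by move=> E; rewrite E /= oddD (negbTE evenM) addbF in oddT.
Qed.

Lemma card_leave_pairs :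
  2 * #|leave triples| =
  #|labelled_pairs W op|.
Proof.
rewrite -(card_ordered_pairs card_leave_edge).
have ff_inj : injective (fun ij : T * T => (f ij.1, f ij.2)).
  by move=> [i j] [i' j'] [/f_inj -> /f_inj ->].
rewrite -(card_imset _ ff_inj); apply: eq_card => -[a b]; rewrite !inE /=.
apply/imsetP/and4P.
  move=> [[i j]]; rewrite inE /= mem_leave => /and3P [ij _ ijW] [-> ->].
  by rewrite !f_notin (inj_eq f_inj).
move=> [/f_onto [i <-] /f_onto [j <-] ij ijW]; exists (i, j) => //.
by rewrite inE /= mem_leave ijW -(inj_eq f_inj) ij.
Qed.

(** The edge [ij] gets the colour [op (f i) (f j)], and [op_inj] makes this proper; the default [c0]
    serves non-edges only. *)
Lemma leave_edge_colourable : W != set0 -> edge_colourable #|W| (leave triples).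
Proof.
move=> /set0Pn [c0 c0W].
pose c (e : {set T}) : 'I_#|W| :=
  enum_rank_in c0W (odflt c0 [pick c | [exists i, exists j,
     [&& i != j, e == [set i; j] & op (f i) (f j) == c]]]).
have cE i j : i != j -> op (f i) (f j) \in W -> enum_val (c [set i; j]) = op (f i) (f j).
  move=> ij ijW; rewrite /c; case: pickP => /= [d|/(_ (op (f i) (f j)))].
    move=> /existsP [k /existsP [l /and3P [kl /eqP E /eqP <-]]].
    have -> : op (f k) (f l) = op (f i) (f j); last by rewrite enum_rankK_in.
    have : k \in [set i; j] by rewrite E !inE eqxx.
    have : l \in [set i; j] by rewrite E !inE eqxx orbT.
    rewrite !inE => lE kE; move: kl.
    case/orP: lE => /eqP ->; case/orP: kE => /eqP ->; rewrite ?eqxx //.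
    by move=> _; rewrite opC // eq_sym.
  move=> /negbT/existsP; case; exists i; apply/existsP; exists j.
  by rewrite ij !eqxx.
exists c => e e' eL e'L ee' /set0Pn [i /setIP [ie ie']].
have [j ij Ee] := card2_set (card_leave_edge eL) ie.
have [k ik Ee'] := card2_set (card_leave_edge e'L) ie'.
move: eL e'L ee'; rewrite {}Ee {}Ee' !mem_leave => /andP [_ jW] /andP [_ kW].
apply: contra_neq => E; congr [set i; _]; apply: f_inj.
have fij : f i != f j by rewrite (inj_eq f_inj).
have fik : f i != f k by rewrite (inj_eq f_inj).
apply: (op_inj lab (f_notin i) (f_notin j) (f_notin k) fij fik).
by rewrite -(cE i j ij jW) -(cE i k ik kW) E.
Qed.

End Labelled.

(** * The obstruction to decomposing [join_K w L] *)

Lemma card_off_diagonal (T : finType) (A : {set T}) :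
  #|[set ij in setX A A | ij.1 != ij.2]| + #|A| = #|A| * #|A|.
Proof.
rewrite -cardsX -[RHS](cardsID [set ij | ij.1 != ij.2]) setIdE; congr (_ + _).
have diag_inj : injective (fun i : T => (i, i)) by move=> ? ? [].
rewrite -(card_imset _ diag_inj); apply: eq_card => -[i j].
rewrite !inE negbK; apply/imsetP/andP => [[k kA [-> ->]]|[/eqP /= -> /andP [jA _]]].
  by rewrite eqxx kA.
by exists j.
Qed.

Section Join.
Variables (u w : nat) (L : {set {set 'I_u}}).
Hypothesis L2 : forall e, e \in L -> #|e| = 2.

Definition nbh p := [set q | [set p; q] \in L].

Variables (S : {set 'I_u}) (x y : 'I_u).
Hypothesis card_L : 2 * #|L| + w * w.-1 = u * w.
Hypothesis S_even : ~~ odd #|S|.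
Hypothesis S_closed : forall p q, p \in S -> [set p; q] \in L -> q \in S.
Hypotheses (xS : x \in S) (yS : y \in S) (xy : x != y).
Hypothesis nbh_full : forall p, p \in S -> p != x -> p != y -> w <= #|nbh p|.
Hypotheses (nbh_x : #|nbh x| + 2 = w) (nbh_y : #|nbh y| + 2 = w).

Local Notation V := ('I_u + 'I_w)%type.

Let L_neq p q : [set p; q] \in L -> p != q.
Proof. by move/L2; rewrite cards2; case: (p != q). Qed.

Lemma join_K_inl p q : p != q ->
  ([set (inl p : V); inl q] \in join_K w L) = ([set p; q] \in L).
Proof.
move=> pq; rewrite inE; apply/orP/idP; last first.
  by move=> pqL; left; apply/imsetP; exists [set p; q] => //; rewrite imsetU1 imset_set1.
case=> [/imsetP [e eL E]|]; last first.
  by rewrite inE => /andP [_ /existsP [i]]; rewrite !inE.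
suff -> : [set p; q] = e by [].
have inl_inj : injective (@inl 'I_u 'I_w) by move=> ? ? [].
by apply: (imset_inj inl_inj); rewrite -E imsetU1 imset_set1.
Qed.

Lemma join_K_inr (a : V) i : a != inr i -> [set a; inr i] \in join_K w L.
Proof.
move=> ai; rewrite inE; apply/orP; right; rewrite inE cards2 ai /=.
by apply/existsP; exists i; rewrite !inE eqxx orbT.
Qed.

Lemma join_K_no_decomposition : ~ has_K3_decomposition (join_K w L).
Proof.
move=> /third_vertex [tau tauP].
(* [R a b c] means that [abc] is the triangle on the edge [ab]; [Rsym] and [Rrot] give invariance
   under all permutations. *)
pose R a b c := [/\ a != b, [set a; b] \in join_K w L & tau a b = c].
have Rsym a b c : R a b c -> R b a c.
  by case=> ab abE <-; have [_ _ E _] := tauP a b ab abE; split; rewrite 1?eq_sym 1?setUC.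
have Rrot a b c : R a b c -> R a c b.
  by case=> ab abE <-; have [n E _ K] := tauP a b ab abE; split; rewrite 1?eq_sym.
have Rfun a b c c' : R a b c -> R a b c' -> c = c' by move=> [_ _ <-] [_ _ <-].
have Rinr p i : R (inl p) (inr i) (tau (inl p) (inr i)).
  by split=> //; apply: join_K_inr.
have Rinl p q c : R (inl p) (inl q) c -> [set p; q] \in L.
  by case=> pq; rewrite join_K_inl.
have Rneq a b c : R a b c -> b != c by move/Rsym/Rrot; case.
(* [m p] collects the new vertices missed by the matching edges at [p]: their triangle with [p]
   contains a second new vertex. *)
pose m p := [set i | if tau (inl p) (inr i) is inr _ then true else false].
have mP p i : reflect (exists j, R (inl p) (inr i) (inr j)) (i \in m p).
  rewrite inE; case E: (tau (inl p) (inr i)) (Rinr p i) => [q|j] Rp; constructor; last by exists j.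
  by move=> [j /(Rfun _ _ _ _ Rp)].
have mPn p i : i \notin m p -> exists q, R (inl p) (inr i) (inl q).
  rewrite inE; case E: (tau (inl p) (inr i)) (Rinr p i) => [q|j] Rp // _; by exists q.
pose B := [set pi : 'I_u * 'I_w | pi.2 \in m pi.1].
pose h1 (pi : 'I_u * 'I_w) := (pi.2, if tau (inl pi.1) (inr pi.2) is inr j then j else pi.2).
pose h2 (pi : 'I_u * 'I_w) : 'I_u * 'I_u := (pi.1, if tau (inl pi.1) (inr pi.2) is inl q then q else pi.1).
(* A triangle [pij] with [i], [j] new is determined by its edge [ij], so [h1] embeds [B] into the
   [w * (w - 1)] ordered pairs of distinct new vertices. *)
have B_le : #|B| + w <= w * w.
  have := card_off_diagonal [set: 'I_w]; rewrite cardsT card_ord => <-; rewrite leq_add2r.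
  have h1_inj : {in B &, injective h1}.
    move=> [p i] [p' i']; rewrite !inE /h1 /=.
    case E: (tau _ _) (Rinr p i) => [//|j] /Rsym/Rrot Rp _.
    case E': (tau _ _) (Rinr p' i') => [//|j'] /Rsym/Rrot Rp' _ [ii jj].
    by move: Rp; rewrite ii jj => /(Rfun _ _ _ _ Rp') [->].
  rewrite -(card_in_imset h1_inj); apply/subset_leq_card/subsetP => _ /imsetP [[p i] + ->].
  rewrite !inE /h1 /=; case E: (tau _ _) (Rinr p i) => [//|j] /Rneq.
  by rewrite (inj_eq (@inr_inj _ _)).
pose P := [set pq : 'I_u * 'I_u | (pq.1 != pq.2) && ([set pq.1; pq.2] \in L)].
have h2_inj : {in ~: B &, injective h2}.
  move=> [p i] [p' i']; rewrite !inE /h2 /=.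
  case E: (tau _ _) (Rinr p i) => [q|//] /Rrot Rp _.
  case E': (tau _ _) (Rinr p' i') => [q'|//] /Rrot Rp' _ [ii jj].
  by move: Rp; rewrite ii jj => /(Rfun _ _ _ _ Rp') [->].
(* Equality in (ii) enters here: by [card_L] and [B_le] the complement of [B] has at least
   [2 * #|L|] elements, as many as there are ordered edges, so the injection [h2] into these is
   onto. *)
have h2_onto : h2 @: (~: B) = P.
  apply/eqP; rewrite eqEcard; apply/andP; split.
    apply/subsetP => _ /imsetP [[p i] + ->]; rewrite !inE /h2 /=.
    case E: (tau _ _) (Rinr p i) => [q|//] /Rrot/Rinl pqL _ /=.
    by rewrite pqL L_neq.
  rewrite card_in_imset // card_ordered_pairs // (_ : 2 * _ = u * w - w * w.-1); last first.
    by rewrite -card_L addnK.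
  have := cardsC B; rewrite card_prod !card_ord => <-.
  have : w * w.-1 + w = w * w by clear; case: w => //= n; rewrite -mulnSr.
  by move: B_le; lia.
have L_joined p q : [set p; q] \in L -> exists i, R (inl p) (inr i) (inl q).
  move=> pqL; have : (p, q) \in P by rewrite inE /= pqL L_neq.
  rewrite -h2_onto => /imsetP [[p' i]]; rewrite !inE /h2 /=.
  by case E: (tau _ _) (Rinr p' i) => [q'|//] Rp _ [-> ->]; exists i.
(* The triangles match the new vertices outside [m p] with the neighbours of [p]; every neighbour is
   reached by [L_joined]. *)
have card_m p : #|m p| + #|nbh p| = w.
  suff -> : #|nbh p| = #|~: m p| by rewrite cardsC card_ord.
  pose h i := if tau (inl p) (inr i) is inl q then q else p.
  have hE i q : R (inl p) (inr i) (inl q) -> h i = q by rewrite /h => -[_ _ ->].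
  have h_inj : {in ~: m p &, injective h}.
    move=> i i'; rewrite !in_setC => /mPn [q Rq] /mPn [q' Rq'].
    rewrite (hE _ _ Rq) (hE _ _ Rq') => qq; move: Rq; rewrite qq => /Rrot Rq.
    by have [] := Rfun _ _ _ _ Rq (Rrot _ _ _ Rq').
  rewrite -(card_in_imset h_inj); apply: eq_card => q; apply/idP/imsetP.
    rewrite inE => /L_joined [i Ri]; exists i; last by rewrite (hE _ _ Ri).
    by rewrite in_setC; apply/mP => -[j /(Rfun _ _ _ _ Ri)].
  move=> [i]; rewrite in_setC => /mPn [q' Ri] ->.
  by rewrite (hE _ _ Ri) inE; apply: (Rinl _ _ (inr i)); apply: Rrot.
have m_full p : p \in S -> p != x -> p != y -> m p = set0.
  move=> pS px py; apply/eqP; rewrite -cards_eq0.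
  by rewrite -leqn0 -(leq_add2r #|nbh p|) add0n card_m nbh_full.
(* No edge leaves [S], so the edges whose triangle contains [i] pair off the vertices of [S] not
   missing [i]. As [S] is even, evenly many vertices of [S] miss [i]. *)
have m_even i : ~~ odd #|[set p in S | i \in m p]|.
  have evenC : ~~ odd #|[set p in S | i \notin m p]|.
    pose s p := if tau (inl p) (inr i) is inl q then q else p.
    have sE p q : R (inl p) (inr i) (inl q) -> s p = q by rewrite /s => -[_ _ ->].
    apply: (involution_even (s := s)) => p; rewrite in_set => /andP [pS /mPn [q Rq]].
    rewrite (sE _ _ Rq) in_set.
    have Rq' := Rsym _ _ _ (Rrot _ _ _ (Rsym _ _ _ Rq)).
    rewrite (sE _ _ Rq') (S_closed pS (Rinl _ _ _ (Rrot _ _ _ Rq))) /=; split=> //.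
      by apply/mP => -[j /(Rfun _ _ _ _ Rq')].
    by rewrite eq_sym; apply: L_neq; apply: Rinl (Rrot _ _ _ Rq).
  have E : #|S| = #|[set p in S | i \in m p]| + #|[set p in S | i \notin m p]|.
    rewrite -(cardsID [set p | i \in m p] S); congr (_ + _); apply: eq_card => p;
    by rewrite !inE // andbC.
  by move: S_even; rewrite E oddD (negbTE evenC) addbF.
(* Within [S] only [x] and [y] can miss a new vertex; if [x] alone missed [i], the count in [m_even]
   would be 1. *)
have m_xy i : i \in m x -> i \in m y.
  move=> ix; apply: contraNT (m_even i) => iy.
  suff -> : [set p in S | i \in m p] = [set x] by rewrite cards1.
  apply/setP => p; rewrite in_set in_set1; have [->|px] := eqVneq p x; first by rewrite xS.
  have [->|py] := eqVneq p y; first by rewrite (negbTE iy) andbF.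
  by apply/negP => /andP [pS]; rewrite m_full // inE.
have /card_gt0P [i ix] : 0 < #|m x| by rewrite -(ltn_add2r #|nbh x|) card_m addnC -[X in _ < X]nbh_x ltn_add2l.
have /mP [j Rx] := ix; have /mP [k Ry] := m_xy _ ix.
have jy : j \in m y by apply: m_xy; apply/mP; exists i; apply: Rrot.
have ky : k \in m y by apply/mP; exists i; apply: Rrot.
have ij : i != j by have := Rneq _ _ _ Rx; rewrite (inj_eq (@inr_inj _ _)).
have ik : i != k by have := Rneq _ _ _ Ry; rewrite (inj_eq (@inr_inj _ _)).
(* Both [j] and [k] are the element of [m y] other than [i]. The edge [ij] then has third vertex [x]
   as well as [y]. *)
have jk : j = k.
  have my2 : #|m y| = 2 by apply/eqP; rewrite -(eqn_add2r #|nbh y|) card_m addnC nbh_y.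
  have [z iz Ez] := card2_set my2 (m_xy _ ix).
  move: jy ky; rewrite Ez !inE ![_ == i]eq_sym (negbTE ij) (negbTE ik) /=.
  by move=> /eqP -> /eqP ->.
subst k; move/negP: xy; apply; apply/eqP.
by have [] := Rfun _ _ _ _ (Rrot _ _ _ (Rsym _ _ _ Rx)) (Rrot _ _ _ (Rsym _ _ _ Ry)).
Qed.

End Join.

(** * From a labelling to the conditions on the leave *)

(** [G] is the whole leave, and the count of labelled pairs makes (ii) an equality. The last two
    hypotheses fix the colours seen at the vertices of [S]: all of [W], except that [x] and [y] miss
    exactly [c] and [d]. Degrees in [S] are therefore [w], and [w - 2] at [x] and [y]. *)
Lemma counterexample_of_labelling (X : finType) (W S : {set X}) (op : X -> X -> X) (x y c d : X) :
  labelling W op -> odd #|~: W| -> ~~ odd #|W| ->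
  #|labelled_pairs W op|
    + #|W| * #|W|.-1 = #|~: W| * #|W| ->
  S \subset ~: W -> ~~ odd #|S| ->
  (forall a b, a \in S -> b \notin W -> b \notin S -> op a b \notin W) ->
  x \in S -> y \in S -> x != y -> c \in W -> d \in W -> c != d ->
  (forall a e, a \in S -> e \in W -> ~~ ((a \in [set x; y]) && (e \in [set c; d])) ->
    exists b, [/\ b \notin W, a != b & op a b = e]) ->
  (forall a b, a \in [set x; y] -> b \notin W -> a != b -> op a b \notin [set c; d]) ->
  let w := #|W| in
  exists (u : nat) (A : {set {set 'I_u}}),
    partial_STS A /\
    (forall x : 'I_u, odd (deg (leave A) x) = odd w) /\
    (0 < w -> odd (u + w)) /\
    (#|leave A| + u * w + 'C(w, 2)) %% 3 = 0 /\
    (exists G : {set {set 'I_u}},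
        G \subset leave A /\
        has_K3_decomposition (leave A :\: G) /\
        (u + 1) * w <= w ^ 2 + 2 * #|G| /\
        edge_colourable w G) /\
    ~ has_K3_decomposition (join_K w (leave A)).
Proof.
move=> lab oddU evenW count SU evenS S_closed xS yS xy cW dW cd full miss w.
pose f (i : 'I_#|~: W|) := enum_val i.
have f_inj : injective f by exact: enum_val_inj.
have f_out i : f i \notin W by have := enum_valP i; rewrite in_setC.
have f_onto a : a \notin W -> exists i, f i = a.
  by rewrite -in_setC => aU; exists (enum_rank_in aU a); rewrite /f enum_rankK_in.
have memL := mem_leave lab f_inj f_out f_onto.
have cardL := card_leave_pairs lab f_inj f_out f_onto.
rewrite -{}cardL in count.
exists #|~: W|, (triples op f); set L := leave _ in count memL *.
have w_gt0 : 0 < w by apply/card_gt0P; exists c.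
have ww : w * w.-1 + w = w * w by case: (w) w_gt0 => // n _; rewrite -mulnSr.
split; first exact: (triples_partial_STS lab).
split.
  move=> i; rewrite (negbTE evenW); apply/negbTE.
  by apply: (deg_leave_even lab) => //; rewrite card_ord.
split; first by rewrite oddD oddU (negbTE evenW).
split.
  (* By the count, twice the quantity in (3) is [3 * u * w], and 2 is coprime to 3. *)
  have C2 : 2 * 'C(w, 2) = w * w.-1 by rewrite -mul_bin_diag bin1.
  rewrite -/w in count; apply/eqP; rewrite -/(dvdn 3 _).
  rewrite -(@Gauss_dvdr 3 2) // !mulnDr C2 addnAC count.
  by apply/dvdnP; exists (#|~: W| * w); rewrite -mulSn mulnC.
split.
  exists L; split=> //; split.
    by exists set0; rewrite setDv; split=> [t|e]; rewrite inE.
  split; last by apply: (leave_edge_colourable lab) => //; apply/set0Pn; exists c.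
  by rewrite -mulnn -ww mulnDl mul1n -count -addnA addnC.
have [x' fx] : exists i, f i = x by apply: f_onto; move/subsetP/(_ x xS): SU; rewrite inE.
have [y' fy] : exists i, f i = y by apply: f_onto; move/subsetP/(_ y yS): SU; rewrite inE.
have card_nbh p : f p \in S ->
    #|nbh L p| = #|W :\: (if f p \in [set x; y] then [set c; d] else set0)|.
  move=> pS; pose h q := op (f p) (f q).
  have h_inj : {in nbh L p &, injective h}.
    move=> q q'; rewrite ![in _ \in nbh _ _]inE !memL => /andP [pq _] /andP [pq' _] E.
    by apply/f_inj/(op_inj lab (f_out p) (f_out q) (f_out q') _ _ E); rewrite (inj_eq f_inj).
  rewrite -(card_in_imset h_inj); apply: eq_card => e; rewrite in_setD.
  apply/imsetP/andP => [[q] | [e_ok eW]].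
    rewrite inE memL => /andP [pq hW] ->; split=> //; case: ifP => [pxy|_]; last by rewrite inE.
    by apply: miss => //; rewrite (inj_eq f_inj).
  have [|b [/f_onto [q <-] pq E]] := full _ e pS eW.
    by move: e_ok; case: ifP.
  by exists q => //; rewrite inE memL -(inj_eq f_inj) pq E.
have cdW : #|W :\: [set c; d]| + 2 = w.
  rewrite cardsD (setIidPr _) ?cards2 ?cd; last by apply/subsetP => e /set2P [] ->.
  rewrite subnK //; apply: leq_trans (subset_leq_card (_ : [set c; d] \subset W)).
    by rewrite cards2 cd.
  by apply/subsetP => e /set2P [] ->.
apply: (@join_K_no_decomposition _ _ _ _ (f @^-1: S) x' y').
- exact: card_leave_edge.
- exact: count.
- suff -> : #|f @^-1: S| = #|S| by [].
  rewrite -(card_imset _ f_inj); apply: eq_card => a; apply/imsetP/idP.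
    by move=> [i]; rewrite inE => ? ->.
  move=> aS; have /f_onto [i fi] : a \notin W by move/subsetP/(_ a aS): SU; rewrite inE.
  by exists i; rewrite ?inE fi.
- move=> p q; rewrite memL !in_set => pS /andP [_]; apply: contraLR => qS.
  exact: S_closed.
- by rewrite inE fx.
- by rewrite inE fy.
- by apply: contra_neq xy => E; rewrite -fx -fy E.
- move=> p; rewrite inE => pS px py; rewrite card_nbh //.
  by rewrite !inE -fx -fy !(inj_eq f_inj) (negbTE px) (negbTE py) setD0.
- by rewrite card_nbh fx // !inE eqxx.
- by rewrite card_nbh fy // !inE eqxx orbT.
Qed.

(** * Steiner triple systems *)

(** A Steiner quasigroup: third points of triples, with idempotence filling in the diagonal. *)
Record steiner_op (V : Type) (op : V -> V -> V) : Prop := SteinerOp {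
  steinerC : forall a b, op a b = op b a;
  steinerK : forall a b, op a (op a b) = b;
  steinerI : forall a, op a a = a }.

Section Steiner.
Variables (V : finType) (op : V -> V -> V).
Hypothesis st : steiner_op op.

Lemma steiner_eql a b : (op a b == a) = (a == b).
Proof.
apply/eqP/eqP => [E|->]; last exact: steinerI.
by rewrite -(steinerK st a b) E steinerI.
Qed.

Lemma steiner_inj a : injective (op a).
Proof. by move=> b c E; rewrite -(steinerK st a b) E steinerK. Qed.

(** Double counting of the pairs [(a, c)] with [a] outside [W] and [c] in [W]. If [op a c] is
    outside [W], then [(a, op a c)] is a labelled pair of colour [c]. Otherwise [c] and [op a c] are
    distinct points of [W], and every ordered pair of distinct points arises, since [W] contains no
    triple. *)
Lemma card_cap_pairs (W : {set V}) :
  {in W &, forall c d, c != d -> op c d \notin W} ->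
  #|labelled_pairs W op|
    + #|W| * #|W|.-1 = #|~: W| * #|W|.
Proof.
move=> cap; rewrite -cardsX -[RHS](cardsID [set ac : V * V | op ac.1 ac.2 \in W]) addnC; congr (_ + _).
  have -> : #|W| * #|W|.-1 = #|[set cd in setX W W | cd.1 != cd.2]|.
    by apply: (@addIn #|W|); rewrite card_off_diagonal addnC; case: #|W| => // n; rewrite mulnS.
  have h_inj : injective (fun cd : V * V => (op cd.1 cd.2, cd.1)).
    by move=> [c d] [c' d'] /= [+ E]; rewrite E => /steiner_inj ->.
  rewrite -[LHS](card_imset _ h_inj); apply: eq_card => -[a c]; rewrite !inE /=.
  apply/imsetP/andP => [[[c' d]]|[/andP [aW cW] acW]].
    rewrite !inE /= => /andP [/andP [cW dW] cd] [-> ->].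
    by rewrite cap // cW [op _ c'](steinerC st) (steinerK st).
  exists (c, op c a); last by rewrite /= (steinerK st).
  have ca : c != op c a by rewrite eq_sym steiner_eql; apply: contraNneq aW => <-.
  by rewrite !inE /= ca cW (steinerC st c) acW.
have h_inj : injective (fun ab : V * V => (ab.1, op ab.1 ab.2)).
  by move=> [a b] [a' b'] /= [<-] /steiner_inj ->.
rewrite -[LHS](card_imset _ h_inj); apply: eq_card => -[a c]; rewrite !inE /=.
apply/imsetP/and3P => [[[a' b]]|[acW aW cW]].
  by rewrite !inE /= => /and4P [aW bW _ cW] [-> ->]; rewrite (steinerK st).
exists (a, op a c); last by rewrite /= (steinerK st).
have ac : a != op a c by rewrite eq_sym steiner_eql; apply: contraNneq aW => ->.
by rewrite !inE /= (steinerK st) aW acW cW ac.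
Qed.

(** The classical passage from order v to 2v+1: [inr None] is the extra point and [inr (Some p)] a
    copy of [p]. Triples not inside the first part have exactly two points in [option V]. *)
Definition doubling (a b : V + option V) : V + option V :=
  match a, b with
  | inl q, inl r => inl (op q r)
  | inl q, inr None | inr None, inl q => inr (Some q)
  | inl q, inr (Some p) | inr (Some p), inl q =>
      inr (if p == q then None else Some (op q p))
  | inr None, inr None => inr None
  | inr None, inr (Some p) | inr (Some p), inr None => inl p
  | inr (Some p), inr (Some r) => if p == r then inr (Some p) else inl (op p r)
  end.

Lemma doubling_steiner : steiner_op doubling.
Proof.
split=> [[a|[a|]] [b|[b|]]|[a|[a|]] [b|[b|]]|[a|[a|]]] //=;
  rewrite ?eqxx ?steinerI ?steinerK //.
- by rewrite (steinerC st).
- by rewrite eq_sym; case: eqP => [->|_] //; rewrite (steinerC st).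
- have [->|ba] := eqVneq b a; rewrite /= ?eqxx //.
  by rewrite steiner_eql eq_sym (negbTE ba) (steinerK st).
- have [->|ab] := eqVneq a b; rewrite /= ?eqxx //.
  by rewrite eq_sym (steinerC st) steiner_eql (negbTE ab) (steinerK st).
- have [->|ab] := eqVneq a b; rewrite /= ?eqxx //.
  by rewrite eq_sym steiner_eql (negbTE ab) (steinerC st _ a) (steinerK st).
Qed.
End Steiner.

(** * Replacing a subsystem *)

Section Overlay.
Variables (X Y : finType) (j : Y -> X) (r : X -> Y) (op : X -> X -> X) (op1 : Y -> Y -> Y).
Variable W : {set X}.
Hypothesis jK : cancel j r.
Hypothesis st : steiner_op op.

Definition in_range : pred X := [pred a | j (r a) == a].
Definition overlay a b := if (a \in in_range) && (b \in in_range) then j (op1 (r a) (r b)) else op a b.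

Hypothesis range_closed : {in in_range &, forall a b, op a b \in in_range}.
Hypothesis lab1 : labelling (j @^-1: W) op1.

Lemma j_in_range y : j y \in in_range. Proof. by rewrite inE jK. Qed.

Lemma in_range_op a b : a \in in_range -> (op a b \in in_range) = (b \in in_range).
Proof.
move=> aY; apply/idP/idP => [abY|bY]; last exact: range_closed.
by rewrite -(steinerK st a b) range_closed.
Qed.

(** The image of [j] is a subsystem, so a triple with two points in it lies in it entirely. The
    conditions hold inside by [lab1], outside by [st], and the two regimes never mix. *)
Lemma overlay_labelling : labelling W overlay.
Proof.
have jr a : a \in in_range -> j (r a) = a by move/eqP.
have r_out a : a \in in_range -> a \notin W -> r a \notin j @^-1: W by move=> /jr; rewrite inE => ->.
have r_neq a b : a \in in_range -> b \in in_range -> a != b -> r a != r b.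
  by move=> /jr aY /jr bY; apply: contra_neq => E; rewrite -aY -bY E.
split.
- move=> a b aW bW ab; rewrite /overlay andbC; case: ifP => [/andP [bY aY]|_].
    by rewrite (op_sym lab1) ?r_out ?r_neq.
  exact: steinerC.
- move=> a b aW bW ab; rewrite /overlay; case: ifP => [/andP [aY bY]|_].
    rewrite -{2}(jr _ aY) (can_eq jK).
    by rewrite (op_neql lab1) ?r_out ?r_neq.
  by rewrite steiner_eql.
- move=> a b aW bW ab; rewrite {1 3}/overlay; case: ifP => [/andP [aY bY] abW|NY abW].
    rewrite /overlay aY j_in_range /= jK (op_invol lab1) ?r_out ?r_neq ?jr //.
    by rewrite inE.
  rewrite /overlay; case: ifP => [/andP [aY]|_]; last exact: steinerK.
  by rewrite in_range_op // => bY; rewrite aY bY in NY.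
- move=> a b c aW bW cW ab ac; rewrite /overlay; case: (boolP (a \in in_range)) => aY /=; last first.
    exact: steiner_inj.
  case: (boolP (b \in in_range)) => bY; case: (boolP (c \in in_range)) => cY.
  + move/(can_inj jK)/(op_inj lab1) => E.
    by rewrite -(jr _ bY) -(jr _ cY) E ?r_out ?r_neq.
  + by move=> E; move: cY; rewrite -(in_range_op c aY) -E j_in_range.
  + by move=> E; move: bY; rewrite -(in_range_op b aY) E j_in_range.
  + exact: steiner_inj.
Qed.

(** The two operations differ only on pairs inside the image of [j], where labelled pairs correspond
    to those of the small operations. *)
Lemma card_overlay_pairs :
  #|labelled_pairs (j @^-1: W) op1| =
    #|labelled_pairs (j @^-1: W) (fun a b => r (op (j a) (j b)))| ->
  #|labelled_pairs W overlay| = #|labelled_pairs W op|.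
Proof.
move=> E.
have jj_inj : injective (fun ab : Y * Y => (j ab.1, j ab.2)).
  by move=> [a b] [a' b'] [/(can_inj jK) -> /(can_inj jK) ->].
pose SS := [set ab : X * X | (ab.1 \in in_range) && (ab.2 \in in_range)].
have restr (o : X -> X -> X) (o1 : Y -> Y -> Y) : (forall a b, o (j a) (j b) = j (o1 a b)) ->
    #|labelled_pairs W o :&: SS| = #|labelled_pairs (j @^-1: W) o1|.
  move=> oE; rewrite -(card_imset _ jj_inj); apply: eq_card => -[a b].
  apply/idP/imsetP => [|[[a' b']] + [-> ->]]; last first.
    by rewrite !inE /= oE !jK !eqxx (can_eq jK) !andbT.
  rewrite inE [_ \in SS]inE => /andP [abP /andP [/eqP /= aY /eqP /= bY]].
  exists (r a, r b); rewrite /= ?aY ?bY //.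
  by move: abP; rewrite -{1}aY -{1}bY !inE /= oE (can_eq jK).
rewrite -(cardsID SS (labelled_pairs W op)) -(cardsID SS (labelled_pairs W overlay)).
congr (_ + _); last first.
  apply: eq_card => -[a b]; rewrite !inE /overlay /=.
  by case: (boolP ((a \in in_range) && (b \in in_range))).
rewrite (restr _ op1) ?E ?(restr op (fun a b => r (op (j a) (j b)))) //.
  by move=> a b; rewrite (eqP (_ : op (j a) (j b) \in in_range)) ?range_closed ?j_in_range.
by move=> a b; rewrite /overlay !j_in_range !jK.
Qed.

End Overlay.

(** * The construction *)

Definition F3 := option bool.

(** Third point on the affine line, that is [-(x + y)]. *)
Definition F3_op (x y : F3) : F3 :=
  match x, y with
  | None, None => None
  | None, Some b | Some b, None => Some (~~ b)
  | Some b, Some c => if b == c then Some b else None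
  end.

Lemma F3_steiner : steiner_op F3_op.
Proof. by split=> [[[]|] [[]|]|[[]|] [[]|]|[[]|]]. Qed.

Lemma pair_steiner (U V : Type) (opU : U -> U -> U) (opV : V -> V -> V) :
  steiner_op opU -> steiner_op opV ->
  steiner_op (fun a b : U * V => (opU a.1 b.1, opV a.2 b.2)).
Proof.
move=> stU stV; split=> [[a a'] [b b']|[a a'] [b b']|[a a']] /=.
- by rewrite (steinerC stU) (steinerC stV).
- by rewrite (steinerK stU) (steinerK stV).
- by rewrite (steinerI stU) (steinerI stV).
Qed.

Lemma ffun_steiner (I : finType) (U : Type) (opU : U -> U -> U) :
  steiner_op opU -> steiner_op (fun a b : {ffun I -> U} => [ffun i => opU (a i) (b i)]).
Proof.
move=> st; split=> [a b|a b|a]; apply/ffunP => i; rewrite !ffunE.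
- exact: steinerC.
- exact: steinerK.
- exact: steinerI.
Qed.

Definition plane := (F3 * F3)%type.
Definition plane_op (a b : plane) : plane := (F3_op a.1 b.1, F3_op a.2 b.2).
Definition pt := (plane + option plane)%type.

Definition lookup (l : seq (pt * pt * pt)) (d : pt -> pt -> pt) (a b : pt) : pt :=
  foldr (fun e r => if (e.1 == (a, b)) || (e.1 == (b, a)) then e.2 else r) (d a b) l.

Definition triple (a b c : pt) := [:: (a, b, c); (a, c, b); (b, c, a)].

Section Table.
Local Notation o := (@None bool).
Local Notation p := (Some true).
Local Notation m := (Some false).
Local Notation Q a b := (inl (a, b) : pt).
Local Notation S a b := (inr (Some (a, b)) : pt).

(** [o], [p], [m] stand for 0, 1, -1 in [F_3]; [W] consists of the points [Q +-1 +-1].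
    An entry [(a, b, c)] overrides the third point of [a], [b] by [c].  The leave
    edges of the 4-cycle [Q p o, Q o p, Q m o, Q o m] are covered by triples
    through the points [S +-1 +-1]; two triples through [x = S p o] and
    [y = S o o] use up four leave edges; and on the [Q]-side the leave becomes two
    triangles through [Q o o], coloured properly by the last six entries. *)
Definition table : seq (pt * pt * pt) :=
  triple (Q p o) (Q o p) (S p p) ++ triple (Q o p) (Q m o) (S m p) ++
  triple (Q m o) (Q o m) (S m m) ++ triple (Q o m) (Q p o) (S p m) ++
  triple (S p o) (S p p) (S p m) ++ triple (S o o) (S m p) (S m m) ++
  [:: (S p p, S m p, Q p m); (S p m, S m m, Q p p);
      (Q o o, Q p o, Q p p); (Q o o, Q m o, Q p m); (Q p o, Q m o, Q m p);
      (Q o o, Q o p, Q m p); (Q o o, Q o m, Q m m); (Q o p, Q o m, Q p p)].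

(** An explicit list, so that statements on the small system can be checked exhaustively by
    [vm_compute]. *)
Definition pts : seq pt :=
  let F := [:: o; p; m] in let A := [seq (a, b) | a <- F, b <- F] in
  map inl A ++ inr None :: map (inr \o Some) A.

Definition corner (y : pt) : bool := if y is inl (Some _, Some _) then true else false.

Definition bad_vertices : seq pt := [:: S p o; S o o].
Definition bad_colours : seq pt := [:: Q p m; Q p p].
End Table.

(** * Exhaustive checks of the replaced small system *)

Definition small_op : pt -> pt -> pt := lookup table (doubling plane_op).

Lemma mem_pts y : y \in pts.
Proof. by case: y => [[[[]|] [[]|]]|[[[[]|] [[]|]]|]]. Qed.

Lemma pts_forall (P : pred pt) : all P pts -> forall y, P y.
Proof. by move=> /allP H y; apply/H/mem_pts. Qed.

Definition is_inr (U V : Type) (a : U + V) : bool := if a is inr _ then true else false.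

(** The first three conjuncts feed the labelling conditions; the last keeps leave edges from joining
    the two sides, which makes [outer] closed. *)
Lemma small_op_ok a b : ~~ corner a -> ~~ corner b -> a != b ->
  [&& small_op a b == small_op b a, small_op a b != a,
      corner (small_op a b) || (small_op a (small_op a b) == b) &
      is_inr a && ~~ is_inr b ==> ~~ corner (small_op a b)].
Proof.
move=> aW bW ab.
have H : all (fun a => all (fun b => [|| corner a, corner b, a == b |
  [&& small_op a b == small_op b a, small_op a b != a,
      corner (small_op a b) || (small_op a (small_op a b) == b) &
      is_inr a && ~~ is_inr b ==> ~~ corner (small_op a b)]]) pts) pts by vm_compute.
by have := pts_forall (pts_forall H a) b; rewrite (negbTE aW) (negbTE bW) (negbTE ab).
Qed.

Lemma small_op_inj a b c : ~~ corner a -> ~~ corner b -> ~~ corner c ->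
  a != b -> a != c -> small_op a b = small_op a c -> b = c.
Proof.
move=> aW bW cW ab ac E.
have H : all (fun a => all (fun b => all (fun c =>
  [|| corner a, corner b, corner c, a == b, a == c, b == c | small_op a b != small_op a c])
    pts) pts) pts by vm_compute.
have := pts_forall (pts_forall (pts_forall H a) b) c.
rewrite (negbTE aW) (negbTE bW) (negbTE cW) (negbTE ab) (negbTE ac) E eqxx orbF.
by move/eqP.
Qed.

Lemma small_op_full a e : is_inr a -> corner e ->
  ~~ ((a \in bad_vertices) && (e \in bad_colours)) ->
  exists b, [/\ ~~ corner b, a != b & small_op a b = e].
Proof.
move=> aS eW ok.
have H : all (fun a => all (fun e =>
    [&& is_inr a, corner e & ~~ ((a \in bad_vertices) && (e \in bad_colours))] ==>
    has (fun b => [&& ~~ corner b, a != b & small_op a b == e]) pts) pts) pts.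
  by vm_compute.
have := pts_forall (pts_forall H a) e; rewrite aS eW ok => /implyP /(_ isT) /hasP.
by move=> [b _ /and3P [bW ab /eqP]]; exists b.
Qed.

Lemma small_op_miss a b : a \in bad_vertices -> ~~ corner b -> a != b ->
  small_op a b \notin bad_colours.
Proof.
move=> aS bW ab.
have H : all (fun a => all (fun b => [|| a \notin bad_vertices, corner b, a == b |
  small_op a b \notin bad_colours]) pts) pts by vm_compute.
by have := pts_forall (pts_forall H a) b; rewrite aS (negbTE bW) (negbTE ab).
Qed.

(** Turns a cardinality into a sum that [vm_compute] can evaluate. *)
Lemma card_pairs_enum (T : finType) (s : seq T) (P : T -> T -> bool) :
  uniq s -> (forall x, x \in s) ->
  #|[set ab : T * T | P ab.1 ab.2]| = sumn [seq count (P a) s | a <- s].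
Proof.
move=> s_uniq sT; pose l := [seq (a, b) | a <- s, b <- s].
have -> : #|[set ab : T * T | P ab.1 ab.2]| = count (fun ab => P ab.1 ab.2) l.
  rewrite -size_filter cardsE cardE; apply/perm_size/uniq_perm; rewrite ?enum_uniq //.
    by rewrite filter_uniq // allpairs_uniq // => -[a b] [].
  move=> [a b]; rewrite mem_enum mem_filter; have -> : (a, b) \in l; last by rewrite andbT.
  by apply/allpairsP; exists (a, b); rewrite !sT.
rewrite /l count_flatten -map_comp; congr sumn; apply: eq_map => a.
by rewrite /= count_map.
Qed.

Lemma card_small_pairs :
  #|labelled_pairs [set y | corner y] small_op| =
  #|labelled_pairs [set y | corner y] (doubling plane_op)|.
Proof.
have pts_uniq : uniq pts by vm_compute.
pose P o a b := [&& ~~ corner a, ~~ corner b, a != b & corner (o a b)].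
have E (o : pt -> pt -> pt) :
    #|labelled_pairs [set y | corner y] o| = sumn [seq count (P o a) pts | a <- pts].
  rewrite -(card_pairs_enum (P o) pts_uniq mem_pts).
  by apply: eq_card => ab; rewrite !inE.
by rewrite !E; vm_compute.
Qed.

(** * The system over F_3^2 x F_3^k *)

Section Big.
Variable k : nat.

Definition space := (plane * {ffun 'I_k -> F3})%type.

Definition space_op (a b : space) : space :=
  (plane_op a.1 b.1, [ffun i => F3_op (a.2 i) (b.2 i)]).

Lemma space_steiner : steiner_op space_op.
Proof.
exact: (pair_steiner (pair_steiner F3_steiner F3_steiner) (@ffun_steiner 'I_k _ _ F3_steiner)).
Qed.

Definition big_pt := (space + option space)%type.
Definition big_op : big_pt -> big_pt -> big_pt := doubling space_op.

Lemma big_steiner : steiner_op big_op.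
Proof. exact: doubling_steiner space_steiner. Qed.

Definition origin : {ffun 'I_k -> F3} := [ffun=> None].

Definition embed (y : pt) : big_pt :=
  match y with
  | inl a => inl (a, origin)
  | inr a => inr (omap (fun a => (a, origin)) a)
  end.

Definition restrict (a : big_pt) : pt :=
  match a with inl v => inl v.1 | inr v => inr (omap fst v) end.

Lemma embedK : cancel embed restrict.
Proof. by case=> [a|[a|]]. Qed.

Lemma space_op_origin a b : space_op (a, origin) (b, origin) = (plane_op a b, origin).
Proof. by congr (_, _); apply/ffunP => i; rewrite !ffunE. Qed.

Lemma embed_op a b : big_op (embed a) (embed b) = embed (doubling plane_op a b).
Proof.
have e (u v : plane) : ((u, origin) == (v, origin)) = (u == v) by rewrite xpair_eqE eqxx andbT.
case: a b => [a|[a|]] [b|[b|]] //=; rewrite ?e ?space_op_origin //; by case: eqP.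
Qed.

Notation slice := (in_range embed restrict).

Lemma slice_closed : {in slice &, forall a b, big_op a b \in slice}.
Proof. by move=> a b /eqP <- /eqP <-; rewrite embed_op j_in_range //; apply: embedK. Qed.

Definition axis (i : 'I_k) : big_pt :=
  inl ((None, None), [ffun j => if j == i then Some true else None]).

(** The unit vectors of F_3^k enlarge the set of four corners to [4 + k] points without creating a
    triple. *)
Definition cap : {set big_pt} := embed @: [set y | corner y] :|: axis @: setT.

Lemma axis_inj : injective axis.
Proof. by move=> i j [/ffunP /(_ i)]; rewrite !ffunE eqxx; case: eqP. Qed.

Lemma axis_slice i : axis i \notin slice.
Proof.
apply/negP => /eqP [/ffunP /(_ i)]; by rewrite !ffunE eqxx.
Qed.

Lemma embed_cap y : (embed y \in cap) = corner y.
Proof.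
rewrite in_setU mem_imset ?inE; last exact: can_inj embedK.
case: (corner y) => //=; apply/negP => /imsetP [i _ E].
by have := axis_slice i; rewrite -E j_in_range //; apply: embedK.
Qed.

Lemma cap_preim : embed @^-1: cap = [set y | corner y].
Proof. by apply/setP => y; rewrite !in_set -embed_cap in_set. Qed.

Lemma card_corner : #|[set y | corner y]| = 4.
Proof.
have pts_uniq : uniq pts by vm_compute.
rewrite (_ : [set y | corner y] = [set:: filter corner pts]).
  by rewrite cardsE (card_uniqP _) ?filter_uniq.
by apply/setP => y; rewrite 2!in_set mem_filter mem_pts andbT.
Qed.

Lemma card_cap : #|cap| = 4 + k.
Proof.
rewrite cardsU disjoint_setI0 ?cards0 ?subn0.
  rewrite card_imset; last exact: can_inj embedK.
  by rewrite card_corner card_imset ?cardsT ?card_ord //; exact: axis_inj.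
rewrite -setI_eq0; apply/eqP/setP => a; rewrite !inE; apply/negP.
move=> /andP [/imsetP [y _ ->] /imsetP [i _ E]].
by have := axis_slice i; rewrite -E j_in_range //; apply: embedK.
Qed.

Lemma capP c : c \in cap -> (exists2 y, corner y & c = embed y) \/ exists i, c = axis i.
Proof.
case/setUP => /imsetP [].
  by move=> y; rewrite inE; left; exists y.
by move=> i _ ->; right; exists i.
Qed.

Lemma cap_coord v : inl v \in cap -> forall i, v.2 i != Some false.
Proof.
move=> /capP [[y _]|[j]].
  by case: y => // a [->] i; rewrite ffunE.
by move=> [->] i; rewrite ffunE; case: (i == j).
Qed.

(** Two corners are checked exhaustively. In the other cases the third point [-(c + d)] has a
    coordinate -1 in F_3^k, which [cap_coord] excludes. *)
Lemma cap_free : {in cap &, forall c d, c != d -> big_op c d \notin cap}.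
Proof.
have corners a b : corner a -> corner b -> a != b -> ~~ corner (doubling plane_op a b).
  have H : all (fun a => all (fun b => [&& corner a, corner b & a != b] ==>
    ~~ corner (doubling plane_op a b)) pts) pts by vm_compute.
  move=> aW bW ab; have := pts_forall (pts_forall H a) b.
  by rewrite aW bW ab => /implyP /(_ isT).
have mixed i y : corner y -> big_op (embed y) (axis i) \notin cap.
  case: y => // a _; apply/negP => /cap_coord /(_ i).
  by rewrite /= !ffunE eqxx.
move=> c d /capP [[y yW ->]|[i ->]] /capP [[z zW ->]|[j ->]].
- rewrite (can_eq embedK) => yz; rewrite embed_op embed_cap; exact: corners.
- by move=> _; apply: mixed.
- by move=> _; rewrite (steinerC big_steiner); apply: mixed.
- move=> ij; apply/negP => /cap_coord /(_ i); rewrite /= !ffunE eqxx.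
  by case: (eqVneq i j) ij => [->|_ _]; rewrite ?eqxx.
Qed.

Definition completed_op : big_pt -> big_pt -> big_pt := overlay embed restrict big_op small_op.

(** This serves as [S]; its size 3^(k+2) + 1 is even. *)
Definition outer : {set big_pt} := [set a | is_inr a].

Lemma completed_labelling : labelling cap completed_op.
Proof.
apply: overlay_labelling embedK big_steiner slice_closed _; rewrite cap_preim.
split=> [a b|a b|a b|a b c]; rewrite ?inE => aW bW.
- by move=> ab; have /and4P [/eqP] := small_op_ok aW bW ab.
- by move=> ab; have /and4P [] := small_op_ok aW bW ab.
- move=> ab /negbTE abW; have /and4P [_ _] := small_op_ok aW bW ab.
  by rewrite abW => /eqP.
- exact: small_op_inj.
Qed.

Lemma completed_count :
  #|labelled_pairs cap completed_op| + #|cap| * #|cap|.-1 = #|~: cap| * #|cap|.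
Proof.
rewrite (card_overlay_pairs embedK slice_closed) ?(card_cap_pairs big_steiner cap_free) //.
rewrite cap_preim card_small_pairs; congr #|pred_of_set _|.
by apply/setP => -[a b]; rewrite !inE /= embed_op embedK.
Qed.

Lemma card_space_odd : odd #|{: space}|.
Proof. by rewrite !card_prod card_ffun !card_option card_bool !oddM oddX orbT. Qed.

Lemma outer_out : outer \subset ~: cap.
Proof.
apply/subsetP => a; rewrite in_set in_setC => aS; apply/negP => /capP [[y yW E]|[i E]].
  by move: aS; rewrite E; case: y yW {E}.
by rewrite E in aS.
Qed.

Lemma outer_even : ~~ odd #|outer|.
Proof.
have -> : outer = inr @: [set: option space].
  apply/setP => -[v|v]; rewrite inE /=; last by rewrite imset_f.
  by apply/esym/imsetP => -[].
rewrite card_imset; last by move=> ? ? [].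
by rewrite cardsT card_option /= card_space_odd.
Qed.

Lemma outside_odd : ~~ odd k -> odd #|~: cap|.
Proof.
move=> evenk; have := cardsC cap; rewrite card_sum card_option card_cap => E.
have : odd (4 + k + #|~: cap|) by rewrite E oddD /= card_space_odd.
by rewrite !oddD (negbTE evenk).
Qed.

Lemma outer_op a e : is_inr a -> ~~ is_inr e -> is_inr (big_op a e).
Proof. by case: a e => [a|[a|]] [e|[e|]]. Qed.

End Big.

(** * Assembly of the counterexample *)

Theorem theorem3 :
  forall w : nat, ~~ odd w -> 4 <= w ->
  exists (u : nat) (A : {set {set 'I_u}}),
    partial_STS A /\
    (forall x : 'I_u, odd (deg (leave A) x) = odd w) /\
    (0 < w -> odd (u + w)) /\
    (#|leave A| + u * w + 'C(w, 2)) %% 3 = 0 /\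
    (exists G : {set {set 'I_u}},
        G \subset leave A /\
        has_K3_decomposition (leave A :\: G) /\
        (u + 1) * w <= w ^ 2 + 2 * #|G| /\
        edge_colourable w G) /\
    ~ has_K3_decomposition (join_K w (leave A)).
Proof.
(* This [k] gives [cap k] exactly [w] points. *)
move=> w evenw w4; set k := w - 4.
have evenk : ~~ odd k by rewrite oddB // addbF.
have wE : w = #|cap k| by rewrite card_cap subnKC.
have slice_embed y : embed k y \in in_range (@embed k) (@restrict k) by apply: j_in_range; apply: embedK.
pose x := embed k (inr (Some (Some true, None))).
pose y := embed k (inr (Some (None, None))).
pose c := embed k (inl (Some true, Some false)).
pose d := embed k (inl (Some true, Some true)).
have xyE a : (a \in [set x; y]) = (a \in [seq embed k z | z <- bad_vertices]) by rewrite !inE.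
have cdE a : (a \in [set c; d]) = (a \in [seq embed k z | z <- bad_colours]) by rewrite !inE.
have embed_inj : injective (@embed k) by exact: can_inj (@embedK k).
have outer_notin a : is_inr a -> a \notin cap k.
  by move=> aS; have /subsetP /(_ a) := outer_out k; rewrite !inE => /(_ aS).
have cap_inl e : e \in cap k -> ~~ is_inr e by apply: contraL; apply: outer_notin.
rewrite wE; apply: (@counterexample_of_labelling _ _ (outer k) (@completed_op k) x y c d).
- exact: completed_labelling.
- exact: outside_odd.
- by rewrite -wE.
- exact: completed_count.
- exact: outer_out.
- exact: outer_even.
(* Inside the slice this is the last conjunct of [small_op_ok]; elsewhere the third point of an
   outer and an inner point is outer, hence not in the cap. *)
- move=> a b; rewrite ![_ \in outer k]in_set => aS bW bS; rewrite /completed_op /overlay.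
  case: ifP => [/andP [/eqP aY /eqP bY]|_]; last by apply/outer_notin/outer_op.
  have raW : ~~ corner (restrict a) by rewrite -(@embed_cap k) aY outer_notin.
  have rbW : ~~ corner (restrict b) by rewrite -(@embed_cap k) bY.
  have rab : restrict a != restrict b by case: (a) (b) aS bS => [?|?] [?|?].
  rewrite embed_cap; have /and4P [_ _ _ /implyP] := small_op_ok raW rbW rab; apply.
  by case: (a) (b) aS bS => [?|?] [?|?].
- by rewrite inE.
- by rewrite inE.
- by rewrite (inj_eq embed_inj).
- by rewrite embed_cap.
- by rewrite embed_cap.
- by rewrite (inj_eq embed_inj).
- move=> a e; rewrite inE => aS eW ok.
  case: (boolP ((a \in in_range (@embed k) (@restrict k)) && (e \in in_range (@embed k) (@restrict k)))).
    move=> /andP [/eqP aY /eqP eY]; move: ok; rewrite xyE cdE -aY -eY !mem_map // => ok.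
    have [||b [bW ab E]] := small_op_full _ _ ok.
    + by case: (a) aS.
    + by rewrite -(@embed_cap k) eY.
    exists (embed k b); rewrite embed_cap bW (inj_eq embed_inj) ab; split=> //.
    by rewrite /completed_op /overlay !slice_embed !embedK E.
  (* Unless [a] and [e] both lie in the slice, the pair of [a] and [big_op a e] keeps its original
     third point, which is [e]. *)
  move=> N; exists (big_op a e); split.
  + exact/outer_notin/outer_op/cap_inl.
  + rewrite eq_sym (steiner_eql (big_steiner k)).
    by apply: contraNneq (cap_inl _ eW) => <-.
  + rewrite /completed_op /overlay; case: ifP => [/andP [aY]|_].
      by rewrite (in_range_op (big_steiner k) (@slice_closed k)) // => eY; rewrite aY eY in N.
    exact: (steinerK (big_steiner k)).
- move=> a b; rewrite xyE => /mapP [z zbad ->] bW; rewrite cdE /completed_op /overlay slice_embed andTb.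
  case: ifP => [/eqP bY|bN] zb.
    rewrite embedK mem_map //; apply: small_op_miss => //.
      by rewrite -(@embed_cap k) bY.
    by move: zb; rewrite -{1}bY (inj_eq embed_inj).
  (* With [b] off the slice the third point is off it too, whereas the bad colours lie in it. *)
  apply/negP => /mapP [t _ E]; move/negP: bN; apply.
  by rewrite -(in_range_op (big_steiner k) (@slice_closed k) b (slice_embed z)) E.
Qed.
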